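(* For any integer $m\geq 3$ and any positive integer $k$, $$\chi_p(K_{m\star k})\leq \left(m+\frac{1}{2}-\sqrt{2m-2}\right)k.$$
   Context: $K_{m\star k}$ denotes the complete multipartite graph with exactly $k$ partite sets, each of size $m$. On-line $f$-list coloring game. Given a finite simple graph $G$ and an integer-valued function $f$ on $V(G)$, two players Alice and Bob play as follows. Initially all vertices are uncolored. In round $i$, Alice marks a nonempty subset $V_i$ of the remaining uncolored vertices (assigning color $i$ as a permissible color to each vertex of $V_i$); then Bob chooses an independent set $X_i\subseteq V_i$ and colors all vertices of $X_i$ with color $i$. If at the end of some round there is a vertex $v$ that has been marked $f(v)$ times but is not yet colored, Alice wins. Otherwise Bob wins, i.e. in the end each vertex $v$ is colored by Bob before running out of $f(v)$ permissible colors. $G$ is on-line $f$-choosable if Bob has a winning strategy, and on-line $k$-choosable if this holds for the constant function $f\equiv k$. The on-line choice number $\chi_p(G)$ (the subscript $p$ is just notation) is the minimum $k$ such that $G$ is on-line $k$-choosable. *)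

(* Defs.v *)
From HB Require Import structures.
From mathcomp Require Import all_boot all_order all_algebra.
(* boolp: only to take the minimum of a Prop-valued predicate on nat. *)
From mathcomp Require Import boolp.

Set Implicit Arguments.
Unset Strict Implicit.
Unset Printing Implicit Defensive.

Record sgraph := SGraph {
  vertex :> finType;
  adj : rel vertex;
  adj_sym : symmetric adj;
  adj_irr : irreflexive adj
}.

Definition independent (G : sgraph) (X : {set G}) : bool :=
  [forall u in X, forall v in X, ~~ adj u v].

Lemma multipartite_sym m k :
  symmetric (fun u v : 'I_k * 'I_m => u.1 != v.1).
Proof. by move=> u v; rewrite eq_sym. Qed.

Lemma multipartite_irr m k :
  irreflexive (fun u v : 'I_k * 'I_m => u.1 != v.1).
Proof. by move=> u; rewrite eqxx. Qed.

(* K_{m * k}: the vertex (i, j) is the j-th vertex of the i-th part, so there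
   are k parts, each of size m. *)
Definition complete_multipartite (m k : nat) : sgraph :=
  SGraph (@multipartite_sym m k) (@multipartite_irr m k).

Definition add_marks (V : finType) (c : {ffun V -> nat}) (M : {set V}) :
  {ffun V -> nat} := [ffun v => c v + (v \in M)].

(* The legal moves of Alice when U is the set of uncolored vertices. *)
Definition alice_move (V : finType) (U M : {set V}) : bool :=
  (M \subset U) && (M != set0).

(* bob_wins f c U: Bob has a winning strategy in the on-line f-list coloring
   game from the position, at the end of a round or before the first one, in
   which U is the set of uncolored vertices and c counts how often each vertex
   has been marked.  The map [reply] gives Bob's answer to each possible move
   of Alice.  Since an uncolored vertex can only be marked fewer than f v times
   while Alice has not won, every play is finite, so the inductive reading
   loses nothing.  When U is empty Alice has no move and Bob has won.  The bound
   is also required before the first round, so that f v = 0 is a loss for Bob. *)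
Inductive bob_wins (G : sgraph) (f : G -> nat)
    (c : {ffun G -> nat}) (U : {set G}) : Prop :=
  BobWins (reply : {set G} -> {set G}) of
      (forall v, v \in U -> c v < f v)
    & (forall M, alice_move U M -> reply M \subset M /\ independent (reply M))
    & (forall M, alice_move U M ->
         bob_wins f (add_marks c M) (U :\: reply M)).

Definition online_choosable (G : sgraph) (f : G -> nat) : Prop :=
  bob_wins f [ffun=> 0] [set: G].

Definition online_kchoosable (G : sgraph) (k : nat) : Prop :=
  @online_choosable G (fun=> k).

(* Bob colors one marked vertex per round, so at any time an uncolored vertex
   has been marked at most as many times as there are colored vertices. *)
Lemma online_kchoosable_card (G : sgraph) : online_kchoosable G #|G|.
Proof.
have greedy n (c : {ffun G -> nat}) (U : {set G}) : #|U| <= n ->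
    (forall v, v \in U -> c v + #|U| <= #|G|) -> bob_wins (fun=> #|G|) c U.
  elim: n c U => [|n IHn] c U leUn cU.
    have U0 : U = set0 by apply/eqP; rewrite -cards_eq0 -leqn0.
    exists id => [v|M|M]; rewrite U0 ?inE //;
      by case/andP; rewrite subset0 => /eqP ->; rewrite eqxx.
  pose reply (M : {set G}) :=
    if [pick x in M] is Some x then [set x] else set0.
  have replyE M : alice_move U M ->
      exists2 x, x \in M & reply M = [set x].
    case/andP=> _ /set0Pn[y yM]; rewrite /reply.
    by case: pickP => [x xM|/(_ y)]; [exists x | rewrite yM].
  exists reply => [v vU|M MU|M MU].
  - apply: leq_trans (cU v vU); rewrite -addn1 leq_add2l card_gt0.
    by apply/set0Pn; exists v.
  - have [x xM ->] := replyE M MU; split; first by rewrite sub1set.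
    apply/forall_inP => u /set1P ->; apply/forall_inP => v /set1P ->.
    by rewrite adj_irr.
  - have [x xM ->] := replyE M MU; case/andP: MU => /subsetP MU _.
    have cardU : #|U| = (#|U :\ x|).+1 by rewrite (cardsD1 x) MU.
    apply: IHn => [|v]; first by rewrite -ltnS -cardU.
    case/setD1P=> _ vU; rewrite ffunE; apply: leq_trans (cU v vU).
    by rewrite cardU addnS -addSn leq_add2r -addn1 leq_add2l leq_b1.
by apply: (greedy #|[set: G]|) => // v _; rewrite ffunE cardsT.
Qed.

Lemma online_kchoosable_ex (G : sgraph) :
  exists k, `[< online_kchoosable G k >].
Proof. by exists #|G|; apply/asboolP; exact: online_kchoosable_card. Qed.

Definition online_choice_number (G : sgraph) : nat :=
  ex_minn (online_kchoosable_ex G).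

Lemma online_choice_numberP (G : sgraph) :
  online_kchoosable G (online_choice_number G) /\
  forall k, online_kchoosable G k -> online_choice_number G <= k.
Proof.
rewrite /online_choice_number; case: ex_minnP => n /asboolP Gn min_n.
by split=> // k Gk; apply: min_n; apply/asboolP.
Qed.

(* Main.v *)
(* Every part of the graph is either free or listed.  Listed parts carry a label
   (j, t) and are ordered by decreasing j, then increasing t.  Writing n v for
   the number of marks v can still take, Bob keeps two invariants:
   - in a free part P, n sums over any Q in P to at least #|Q| plus
     [weight P' 0 + ... + weight P' (#|Q| - 1)] for each other part P';
   - in a listed part, n v exceeds the total demand of the other parts.
   Bob's reply, coloring all marked vertices of a single part:
   1. a free part that is entirely marked, if there is one;
   2. otherwise a free part having a marked set Q on which the first invariant
      is an equality, with #|Q| maximal; what remains of the part is put at the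
      end of the parts listed with j = #|Q|;
   3. otherwise, if t is the maximal number of marked vertices in a free part,
      the first marked listed part provided it has j >= t; failing this, a free
      part with t marked vertices, which stays free unless only one vertex
      remains, in which case it is listed first.
   For K_{m * k} with all parts free, constant f = N is enough as soon as
   c_q (k - 1) + q <= q N for 1 <= q <= m, where
   c_q = (q - 1) m + 1 - q (q - 1) / 2, and c_q / q is at most
   m + 1/2 - sqrt (2 m - 2) because (sqrt (2 m - 2) - q)^2 >= 0. *)
Require Import Defs.
From mathcomp Require Import all_boot all_order all_algebra.
From mathcomp Require Import zify ring lra.
Import Order.TTheory GRing.Theory Num.Theory.

Set Implicit Arguments.
Unset Strict Implicit.
Unset Printing Implicit Defensive.

(** * Labels, weights and demands *)

(* None: a free part; Some (j, t): a listed part. *)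
Definition label := option (nat * nat).

(* With truncated subtraction, (p - l.+1).+1 is max(1, p - l). *)
Definition weight (s : label) (p l : nat) : nat :=
  match s with
  | None => if l is 0 then 1 else (p - l.+1).+1
  | Some x => (0 < l <= x.1) * p
  end.

(* Ties count as preceding, so that labels need not be distinct. *)
Definition precedes (y x : nat * nat) : bool :=
  (x.1 < y.1) || (x.1 == y.1) && (y.2 <= x.2).

(** For [x.1 > 0] a free part demands [weight None p x.1], the price of enlarging a set of size
    [x.1] by one vertex. *)
Definition demand (x : nat * nat) (s : label) (p : nat) : nat :=
  match s with
  | None => (p - x.1.+1).+1
  | Some y => precedes y x * p
  end.

Definition cumul (s : label) (p q : nat) : nat := \sum_(l < q) weight s p l.

(** * Estimates for cumulated weights *)

Lemma leq_cumul_free p q : q <= cumul None p q.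
Proof.
rewrite /cumul -[q in q <= _]card_ord -sum1_card leq_sum // => -[[|l] ?] _ //.
Qed.

Lemma cumul_listed j k p q : cumul (Some (j, k)) p q = minn q.-1 j * p.
Proof.
rewrite /cumul; elim: q => [|q IHq]; first by rewrite big_ord0 min0n.
rewrite big_ord_recr /= {}IHq; case: q => [|q] //=; first by rewrite addn0.
by rewrite -mulnDl; congr (_ * _); lia.
Qed.

Lemma cumul_SS p q :
  cumul None p q.+2 = (p - 2).+2 + \sum_(l < q) (p - l.+3).+1.
Proof. by rewrite /cumul 2!big_ord_recl /= addnA. Qed.

(** Every weight drops, except possibly at [l = r]: the new one is 0 at [l = 0] and beyond [r], and
    in between [p' <= p - r < p - l]. *)
Lemma cumul_tight_drop r k p p' q : 0 < r -> 0 < p' -> p' + r <= p ->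
  cumul (Some (r, k)) p' q + (q - (r < q)) <= cumul None p q.
Proof.
move=> r0 p0 pr.
have -> : q - (r < q) = \sum_(l < q) (l != r :> nat).
  elim: q => [|q IHq]; first by rewrite big_ord0.
  rewrite big_ord_recr /= -IHq ltnS; case: (ltngtP r q) => /= rq; lia.
rewrite /cumul -big_split leq_sum // => -[[|l] lq] _ /=; first by lia.
by case: (ltngtP l.+1 r); lia.
Qed.

(** The term at [l = 1] alone falls by [t], untruncated as two vertices remain. *)
Lemma cumul_free_drop t p q : t.+2 <= p ->
  cumul None (p - t) q + minn q.-1 t <= cumul None p q.
Proof.
move=> tp; case: q => [|[|q]].
- by rewrite min0n addn0 /cumul !big_ord0.
- by rewrite min0n addn0 /cumul !big_ord1.
rewrite !cumul_SS /=.
have: \sum_(l < q) (p - t - l.+3).+1 <= \sum_(l < q) (p - l.+3).+1.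
  by apply: leq_sum => l _; lia.
by move: (\sum_(l < q) _) (\sum_(l < q) _) => a b; lia.
Qed.

Lemma cumul_free_last t q : 0 < t ->
  q.-1 + minn q.-1 t <= cumul None t.+1 q.
Proof.
move=> t0; case: q => [|[|q]]; rewrite ?min0n // cumul_SS /=.
have: q <= \sum_(l < q) (t.+1 - l.+3).+1.
  by rewrite -[q in q <= _]card_ord -sum1_card leq_sum.
by move: (\sum_(l < q) _) => a; lia.
Qed.

(** As [q <= p], no term is truncated; the arithmetic sum is doubled to stay in [nat]. *)
Lemma cumul_freeE p q : 0 < q <= p ->
  2 * cumul None p q + q * q.-1 = 2 * (q.-1 * p) + 2.
Proof.
case: q => // q /= qp; elim: q qp => [|q IHq] qp.
  by rewrite /cumul big_ord1.
rewrite /cumul big_ord_recr /= -/(cumul _ _ _) -/(cumul None p q.+1).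
by have := IHq (ltnW qp); rewrite /=; nia.
Qed.

(** * The invariants and their change in one round *)

Section Strategy.

Variables (V I : finType) (part_of : V -> I).
Implicit Types (U M Q : {set V}) (n : V -> nat) (lab : I -> label) (i h : I).

Definition part U i : {set V} := [set v in U | part_of v == i].

Definition bound U lab i q : nat :=
  \sum_(h | h != i) cumul (lab h) #|part U h| q + q.

Definition tight U n lab i Q : bool :=
  \sum_(v in Q) n v == bound U lab i #|Q|.

Definition safe_part U n lab i : Prop :=
  match lab i with
  | None => forall Q, Q \subset part U i ->
      bound U lab i #|Q| <= \sum_(v in Q) n v
  | Some x => forall v, v \in part U i ->
      \sum_(h | h != i) demand x (lab h) #|part U h| < n v
  end.

Definition safe U n lab : Prop := forall i, safe_part U n lab i.

Definition relabel lab h (s : label) : I -> label :=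
  fun i => if i == h then s else lab i.

Definition mark n M : V -> nat := fun v => n v - (v \in M).

Lemma safe_gt0 U n lab v : safe U n lab -> v \in U -> 0 < n v.
Proof.
move=> /(_ (part_of v)); rewrite /safe_part => sUn vU.
have vP : v \in part U (part_of v) by rewrite inE vU eqxx.
case: (lab _) sUn => [x /(_ v vP)|/(_ [set v])]; first exact: leq_ltn_trans.
by rewrite sub1set vP big_set1 cards1 /bound addn1 => /(_ isT); apply: leq_ltn_trans.
Qed.

Lemma part_other U M h i : i != h -> part (U :\: (part U h :&: M)) i = part U i.
Proof.
move=> ih; apply/setP => v; rewrite !inE.
by have [->|] := eqVneq (part_of v) i; rewrite ?andbF // (negbTE ih) andbF.
Qed.

Lemma part_same U M h : part (U :\: (part U h :&: M)) h = part U h :\: M.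
Proof.
apply/setP => v; rewrite !inE; case: (v \in U) => /=; rewrite ?andbF ?andbT //.
by case: (_ == _); rewrite ?andbF //= andbT.
Qed.

Lemma sum_mark n M Q : (forall v, v \in Q -> 0 < n v) ->
  \sum_(v in Q) mark n M v + #|Q :&: M| = \sum_(v in Q) n v.
Proof.
move=> n0.
have -> : #|Q :&: M| = \sum_(v in Q) (v \in M).
  rewrite -sum1_card big_mkcond [RHS]big_mkcond; apply: eq_bigr => v _.
  by rewrite inE; case: (v \in Q).
rewrite -big_split; apply: eq_bigr => v vQ /=; rewrite subnK //.
by apply: leq_trans (n0 v vQ); exact: leq_b1.
Qed.

(* The summand [~~ tight U n lab i Q] is the unit of slack in the invariant of a
   set that is not tight. *)
Lemma safe_relabel U n lab M h s :
  M \subset U -> safe U n lab ->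
  (forall i Q, i != h -> lab i = None -> Q \subset part U i ->
     cumul s #|part U h :\: M| #|Q| + #|Q :&: M|
       <= cumul (lab h) #|part U h| #|Q| + ~~ tight U n lab i Q) ->
  (forall i x v, i != h -> lab i = Some x -> v \in part U i ->
     demand x s #|part U h :\: M| + (v \in M)
       <= demand x (lab h) #|part U h|) ->
  match s with
  | None => lab h = None
  | Some x => forall v, v \in part U h :\: M ->
      \sum_(i | i != h) demand x (lab i) #|part U i| < n v
  end ->
  safe (U :\: (part U h :&: M)) (mark n M) (relabel lab h s).
Proof.
move=> MU sU C1 C2 C3 i.
have [->|ih] := eqVneq i h.
  rewrite /safe_part {1}/relabel eqxx part_same.
  have others F : \sum_(i0 | i0 != h)
      F (relabel lab h s i0) #|part (U :\: part U h :&: M) i0|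
      = \sum_(i0 | i0 != h) F (lab i0) #|part U i0| :> nat.
    by apply: eq_bigr => g gh; rewrite /relabel (negbTE gh) part_other.
  case: s {C1 C2} C3 others => [x C3|labh] others.
    move=> v vP; rewrite (others (demand x)) /mark.
    by have:= vP; rewrite inE => /andP[/negbTE-> _]; rewrite subn0; apply: C3.
  (* The vertices left in part [h] are unmarked, so the old inequality for [Q] still applies. *)
  move=> Q QP; rewrite /bound (others (fun s p => cumul s p _)).
  have QP' : Q \subset part U h by apply: subset_trans QP (subsetDl _ _).
  have := sU h; rewrite /safe_part labh => /(_ Q QP'); move/leq_trans; apply.
  apply: leq_sum => v vQ; rewrite /mark.
  by have := subsetP QP v vQ; rewrite inE => /andP[/negbTE-> _]; rewrite subn0.
have others F : \sum_(i0 | i0 != i)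
    F (relabel lab h s i0) #|part (U :\: part U h :&: M) i0| + F (lab h) #|part U h|
    = \sum_(i0 | i0 != i) F (lab i0) #|part U i0| + F s #|part U h :\: M| :> nat.
  rewrite (bigD1 h) 1?eq_sym //= [in RHS](bigD1 h) 1?eq_sym //=.
  rewrite /relabel eqxx part_same.
  rewrite (eq_bigr (fun g => F (lab g) #|part U g|)); first by lia.
  by move=> g /andP[_ gh]; rewrite (negbTE gh) part_other.
have := sU i; rewrite /safe_part {1}/relabel (negbTE ih) part_other //.
case E: (lab i) => [x|] sUi.
  move=> v vP; have := others (demand x); have := sUi v vP.
  by have := C2 i x v ih E vP; rewrite /mark; lia.
move=> Q QP; have := others (fun s p => cumul s p #|Q|); rewrite /=.
have := C1 i Q ih E QP; have := sUi Q QP.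
have := @sum_mark n M Q; rewrite /tight /bound.
have n0 v : v \in Q -> 0 < n v.
  by move=> /(subsetP QP); rewrite inE => /andP[vU _]; apply: safe_gt0 sU vU.
by move=> /(_ n0); case: eqP => /=; lia.
Qed.


(** * Replies to an entirely marked part or a marked tight set *)

Lemma leq_demand_size x s p p' : p' <= p -> demand x s p' <= demand x s p.
Proof.
by move=> pp; case: s => [y|] /=; rewrite ?leq_mul // ltnS leq_sub2r.
Qed.

(** The emptied part weighs nothing; before, it weighed at least 1 at each level, which pays for all
    marks elsewhere. *)
Lemma safe_full U n lab M h :
  M \subset U -> safe U n lab -> lab h = None -> part U h \subset M ->
  safe (U :\: (part U h :&: M)) (mark n M) (relabel lab h (Some (0, 0))).
Proof.
move=> MU sU labh hM.
have p0 : part U h :\: M = set0 by apply/eqP; rewrite setD_eq0.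
apply: safe_relabel => // [i Q _ _ _|i x v _ _ _|v]; rewrite p0 ?inE //.
  rewrite cards0 cumul_listed muln0 add0n labh; apply: leq_trans (leq_addr _ _).
  by apply: leq_trans (leq_cumul_free _ _); rewrite subset_leq_card ?subsetIl.
by rewrite cards0 labh /= muln0; case: (v \in M).
Qed.

Lemma safe_tight U n lab M h Q0 K :
  M \subset U -> safe U n lab -> lab h = None -> ~~ (part U h \subset M) ->
  Q0 \subset part U h :&: M -> Q0 != set0 -> tight U n lab h Q0 ->
  (forall i Q, lab i = None -> Q \subset part U i :&: M ->
     tight U n lab i Q -> #|Q| <= #|Q0|) ->
  (forall i x, lab i = Some x -> x.2 <= K) ->
  safe (U :\: (part U h :&: M)) (mark n M)
    (relabel lab h (Some (#|Q0|, K.+1))).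
Proof.
move=> MU sU labh hM Q0h Q00 tQ0 maxQ0 leK.
have r0 : 0 < #|Q0| by rewrite card_gt0.
have p0 : 0 < #|part U h :\: M| by rewrite card_gt0 setD_eq0.
have pr : #|part U h :\: M| + #|Q0| <= #|part U h|.
  by rewrite addnC -(cardsID M (part U h)) leq_add2r subset_leq_card.
apply: safe_relabel => // [i Q ih labi Qi|i x v ih labi vi|v vP].
- have := cumul_tight_drop K.+1 #|Q| r0 p0 pr; rewrite labh.
  have := subset_leq_card (subsetIl Q M).
  (* A tight [Q] inside [M] has [#|Q| <= #|Q0|], so the weights drop by all of [#|Q|]. Otherwise
     [#|Q|.-1] is enough, by slack or by an unmarked vertex. *)
  case: (boolP (Q \subset M)) => QM.
    have := maxQ0 i Q labi; rewrite subsetI Qi QM => /(_ isT).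
    by case: (tight _ _ _ _ _) => [/(_ isT)|_] /=; lia.
  have /proper_card : Q :&: M \proper Q by rewrite properE subsetIl subsetI subxx.
  by lia.
(* Because of [K.+1], [h] precedes only the parts listed with [j < #|Q0|]. *)
- have := leK i x labi; rewrite labh /= /precedes /=.
  by case: (v \in M); case: ltngtP => /=; lia.
- have [vh vM] : v \in part U h /\ v \notin M by move: vP; rewrite inE => /andP[].
  have vQ0 : v \notin Q0.
    by apply: contra vM => /(subsetP Q0h); rewrite inE => /andP[].
  (* Subtracting the equality for [Q0] from the inequality for [v |: Q0] leaves the weights at level
     [#|Q0|], which are the demands for the new label. *)
  have := sU h; rewrite /safe_part labh => /(_ (v |: Q0)).
  rewrite subUset sub1set vh (subset_trans Q0h (subsetIl _ _)) => /(_ isT).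
  rewrite big_setU1 //= (eqP tQ0) cardsU1 vQ0 /bound.
  have -> : \sum_(i | i != h) cumul (lab i) #|part U i| (1 + #|Q0|) =
      \sum_(i | i != h) cumul (lab i) #|part U i| #|Q0| +
      \sum_(i | i != h) weight (lab i) #|part U i| #|Q0|.
    by rewrite -big_split; apply: eq_bigr => i _; rewrite /cumul add1n big_ord_recr.
  have -> : \sum_(i | i != h) demand (#|Q0|, K.+1) (lab i) #|part U i| =
      \sum_(i | i != h) weight (lab i) #|part U i| #|Q0|.
    apply: eq_bigr => i _; case E: (lab i) => [x|] /=; last by case: #|Q0| r0.
    rewrite /precedes /= r0 (leq_trans (leK _ _ E)) // andbT.
    by rewrite [#|Q0| <= _]leq_eqVlt orbC.
  by lia.
Qed.

Lemma card_marked_untight U n lab M i Q t :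
  (Q \subset M -> Q != set0 -> ~~ tight U n lab i Q) ->
  #|Q :&: M| <= t -> #|Q :&: M| <= minn #|Q|.-1 t + ~~ tight U n lab i Q.
Proof.
move=> uQ leQ; have [->|Q0] := eqVneq Q set0; first by rewrite set0I cards0.
have := card_gt0 Q; rewrite Q0.
case: (boolP (Q \subset M)) => QM.
  by move: leQ; rewrite (setIidPl QM) uQ //=; lia.
have /proper_card : Q :&: M \proper Q by rewrite properE subsetIl subsetI subxx.
by move: leQ; lia.
Qed.

(** * Replies when no marked set is tight *)

Section Untight.

Variables (U M : {set V}) (n : V -> nat) (lab : I -> label) (t : nat).
Hypotheses (MU : M \subset U) (sU : safe U n lab).
Hypothesis untight : forall i Q, lab i = None -> Q \subset part U i :&: M ->
  Q != set0 -> ~~ tight U n lab i Q.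
Hypothesis max_t : forall i, lab i = None -> #|part U i :&: M| <= t.

Let card_marked i Q : lab i = None -> Q \subset part U i ->
  #|Q :&: M| <= minn #|Q|.-1 t + ~~ tight U n lab i Q.
Proof.
move=> labi Qi; apply: card_marked_untight => [QM Q0|].
  by apply: untight; rewrite // subsetI Qi.
by apply: leq_trans (max_t labi); rewrite subset_leq_card // setSI.
Qed.

(** A vertex leaves [h], so its weight drops at levels 1 to [x.1], and so does its demand on every
    other marked listed part. *)
Lemma safe_listed h x : lab h = Some x -> t <= x.1 ->
  part U h :&: M != set0 ->
  (forall i y, lab i = Some y -> part U i :&: M != set0 -> precedes x y) ->
  safe (U :\: (part U h :&: M)) (mark n M) (relabel lab h (Some x)).
Proof.
case: x => j k labh tj hM firsth.
have pp : #|part U h :\: M| < #|part U h|.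
  by rewrite -(cardsID M (part U h)) -[X in X < _]add0n ltn_add2r card_gt0.
apply: safe_relabel => // [i Q ih labi Qi|i y v ih labi vi|v vP]; rewrite ?labh.
- have := card_marked labi Qi; rewrite !cumul_listed.
  have := leq_mul (leqnn (minn #|Q|.-1 j)) pp; rewrite mulnS.
  by move: tj => /=; lia.
- case: (boolP (v \in M)) => vM; last by rewrite addn0 leq_demand_size // ltnW.
  rewrite /demand (firsth i y) //; first by rewrite !mul1n addn1.
  by apply/set0Pn; exists v; rewrite inE vi.
- have := sU h; rewrite /safe_part labh; apply.
  by move: vP; rewrite inE => /andP[].
Qed.

Hypothesis unlisted : forall i x, lab i = Some x -> part U i :&: M != set0 ->
  x.1 < t.

Variables (h : I).
Hypotheses (labh : lab h = None) (th : #|part U h :&: M| = t) (t0 : 0 < t).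

Lemma safe_keep : t.+2 <= #|part U h| ->
  safe (U :\: (part U h :&: M)) (mark n M) (relabel lab h None).
Proof.
move=> tp; have pE : #|part U h :\: M| = #|part U h| - t by rewrite cardsD th.
apply: safe_relabel => // [i Q ih labi Qi|i y v ih labi vi]; rewrite labh pE.
  by have := card_marked labi Qi; have := cumul_free_drop #|Q| tp; lia.
case: (boolP (v \in M)) => vM; last by rewrite addn0 leq_demand_size // leq_subr.
have := unlisted labi; have -> : part U i :&: M != set0.
  by apply/set0Pn; exists v; rewrite inE vi.
by move=> /(_ isT) /=; lia.
Qed.

(** With [K] this large the last vertex precedes every listed part and each free part demands only 1
    of it, so the invariant of its singleton suffices. *)
Lemma safe_last K : #|part U h| = t.+1 -> #|V| <= K ->
  (forall i x, lab i = Some x -> x.1 < K) ->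
  safe (U :\: (part U h :&: M)) (mark n M) (relabel lab h (Some (K, 0))).
Proof.
move=> tp VK ltK.
have pE : #|part U h :\: M| = 1 by rewrite cardsD th tp subSnn.
apply: safe_relabel => // [i Q ih labi Qi|i y v ih labi vi|v vP]; rewrite ?pE.
- have := card_marked labi Qi; have := cumul_free_last #|Q| t0; rewrite labh tp.
  by rewrite cumul_listed muln1; lia.
- rewrite labh tp /= /precedes /= (ltK i y labi) /=.
  case: (boolP (v \in M)) => vM; last by lia.
  have := unlisted labi; have -> : part U i :&: M != set0.
    by apply/set0Pn; exists v; rewrite inE vi.
  by move=> /(_ isT) /=; lia.
- have vh : v \in part U h by move: vP; rewrite inE => /andP[].
  have := sU h; rewrite /safe_part labh => /(_ [set v]).
  rewrite sub1set vh big_set1 cards1 /bound addn1 => /(_ isT); apply: leq_trans.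
  rewrite ltnS; apply: leq_sum => i _; rewrite /cumul big_ord1.
  case E: (lab i) => [x|] /=.
    by have := ltK i x E; rewrite /precedes /=; case: ltngtP.
  have := subset_leq_card (subsetT (part U i)); rewrite cardsT; lia.
Qed.

End Untight.

(** * Choice of the reply *)

Lemma safe_step U n lab M : safe U n lab -> M \subset U -> M != set0 ->
  exists h s, part U h :&: M != set0 /\
    safe (U :\: (part U h :&: M)) (mark n M) (relabel lab h s).
Proof.
move=> sU MU M0.
pose free i := lab i == None; pose lbl i := odflt (0, 0) (lab i).
have lblE i x : lab i = Some x -> lbl i = x by rewrite /lbl => ->.
pose K1 := \max_i (lbl i).1; pose K2 := \max_i (lbl i).2.
case: (pickP (fun h => [&& free h, part U h :&: M != set0 & part U h \subset M])).
  move=> h /and3P[/eqP labh hM hsub]; exists h, (Some (0, 0)); split=> //.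
  exact: safe_full.
move=> nofull.
pose mtight (z : I * {set V}) := [&& free z.1, z.2 \subset part U z.1 :&: M,
  z.2 != set0 & tight U n lab z.1 z.2].
case: (pickP mtight) => [z0 tz0|notight].
  case: (arg_maxnP (fun z : I * {set V} => #|z.2|) tz0) => -[h Q0] /and4P[/=].
  move=> /eqP labh Q0h Q00 tQ0 maxQ0.
  have hM : part U h :&: M != set0.
    by case/set0Pn: Q00 => v vQ; apply/set0Pn; exists v; apply: subsetP vQ.
  exists h, (Some (#|Q0|, K2.+1)); split=> //; apply: safe_tight => //.
  - by have := nofull h; rewrite /free labh hM /= => ->.
  - move=> i Q labi Qi tQ; have [->|Qn0] := eqVneq Q set0; first by rewrite cards0.
    by apply: (maxQ0 (i, Q)); rewrite /mtight /free labi Qi Qn0 tQ.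
  - by move=> i x /lblE <-; rewrite /K2 (bigD1 i) //= leq_maxl.
have untight i Q : lab i = None -> Q \subset part U i :&: M ->
    Q != set0 -> ~~ tight U n lab i Q.
  by move=> labi Qi Q0; have := notight (i, Q); rewrite /mtight /free labi Qi Q0 /= => ->.
pose t := \max_(i | free i) #|part U i :&: M|.
have max_t i : lab i = None -> #|part U i :&: M| <= t.
  by move=> labi; rewrite /t (bigD1 i) /free ?labi //= leq_maxl.
pose mlisted i := [&& ~~ free i, part U i :&: M != set0 & t <= (lbl i).1].
case: (pickP mlisted) => [h0 mh0|nolist].
  (* First in the list: largest first component, then smallest second one. *)
  case: (arg_maxnP (fun i => (lbl i).1) mh0) => h1 mh1 max1.
  pose P i := mlisted i && ((lbl h1).1 <= (lbl i).1).
  have Ph1 : P h1 by rewrite /P mh1 /=.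
  case: (arg_minnP (fun i => (lbl i).2) Ph1) => h /andP[/and3P[labh hM th] jh] min2.
  exists h, (Some (lbl h)); split=> //.
  have labhE : lab h = Some (lbl h) by move: labh; rewrite /free /lbl; case: (lab h).
  apply: (safe_listed (t := t)) => // i y labi iM; rewrite /precedes -(lblE _ _ labi).
  case: (leqP t (lbl i).1) => [ti|]; last by move=> ?; apply/orP; left; lia.
  have mi : mlisted i by rewrite /mlisted /free labi iM -(lblE _ _ labi).
  have := max1 i mi; have := min2 i; rewrite /P mi /=.
  by case: ltngtP => //=; [lia | move=> E /(_ _) H _; apply: H; lia].
have unlisted i x : lab i = Some x -> part U i :&: M != set0 -> x.1 < t.
  move=> labi iM; have := nolist i; rewrite /mlisted /free labi iM /= (lblE _ _ labi).
  by case: ltnP.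
have t0 : 0 < t.
  case/set0Pn: M0 => v vM; set i := part_of v.
  have iM : part U i :&: M != set0.
    by apply/set0Pn; exists v; rewrite !inE vM eqxx (subsetP MU v vM).
  case E: (lab i) => [x|]; first exact: leq_ltn_trans (unlisted i x E iM).
  by apply: leq_trans (max_t i E); rewrite card_gt0.
have [h [labh th]] : exists h, lab h = None /\ #|part U h :&: M| = t.
  case: (pickP free) => [i0 fi0|nofree]; last by move: t0; rewrite /t big_pred0.
  have := @eq_bigmax_cond _ free (fun i => #|part U i :&: M|).
  case; first by apply/card_gt0P; exists i0.
  by move=> h /eqP labh tE; exists h; rewrite -tE.
have hM : part U h :&: M != set0 by rewrite -card_gt0 th.
exists h.
have tp : t < #|part U h|.
  have := nofull h; rewrite /free labh hM /= => /negbT hn.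
  rewrite -th proper_card // properE subsetIl subsetI subxx /= hn //.
case: (ltngtP t.+1 #|part U h|) tp => // tp _.
  by exists None; split=> //; apply: (safe_keep (t := t)).
exists (Some (maxn #|V| K1.+1, 0)); split=> //.
apply: (safe_last (t := t)) => //; first by rewrite leq_maxl.
move=> i x /lblE <-; apply: leq_trans (leq_maxr _ _); rewrite ltnS.
by rewrite /K1 (bigD1 i) //= leq_maxl.
Qed.

End Strategy.

(** * From the invariants to a winning strategy *)

Lemma safe_bob_wins (G : sgraph) (I : finType) (part_of : G -> I)
    (f : G -> nat) (c : {ffun G -> nat}) (U : {set G}) (lab : I -> label) :
  (forall u v, adj u v = (part_of u != part_of v)) ->
  safe part_of U (fun v => f v - c v) lab -> bob_wins f c U.
Proof.
move=> adjE; have [N] := ubnP #|U|; elim: N => // N IHN in c U lab *.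
rewrite ltnS => UN sU.
pose good (M X : {set G}) := alice_move U M ->
  [/\ X \subset M, independent X & bob_wins f (add_marks c M) (U :\: X)].
(* Legality of [M] is a premise inside [good], so finite choice yields a total [reply]. *)
have /fin_all_exists[reply replyP] : forall M, exists X, good M X.
  move=> M; have [/andP[MU M0]|nM] := boolP (alice_move U M); last first.
    by exists set0 => aM; rewrite aM in nM.
  have [h [s [hM sU']]] := safe_step sU MU M0.
  exists (part part_of U h :&: M) => _; split; first exact: subsetIr.
    apply/forall_inP => u; rewrite !inE => /andP[/andP[_ /eqP uh] _].
    apply/forall_inP => v; rewrite !inE => /andP[/andP[_ /eqP vh] _].
    by rewrite adjE uh vh eqxx.
  apply: (IHN _ _ (relabel lab h s)).
    apply: leq_trans UN; apply: proper_card; rewrite properE subsetDl /=.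
    case/set0Pn: hM => v vh; apply/subsetPn; exists v; last by rewrite inE vh.
    by move: vh; rewrite !inE => /andP[/andP[]].
  congr (safe part_of _ _ _): sU'; apply: boolp.funext => v.
  by rewrite /mark ffunE subnDA.
exists reply => [v vU|M /replyP[]|M /replyP[]] //.
by have := safe_gt0 sU vU; rewrite subn_gt0.
Qed.

(** * Complete multipartite graphs *)

Lemma card_multipartite_part (m k : nat) (h : 'I_k) :
  #|part fst [set: 'I_k * 'I_m] h| = m.
Proof.
have -> : part fst [set: 'I_k * 'I_m] h = [set (h, j) | j : 'I_m].
  apply/setP => -[a b]; rewrite !inE /=; apply/eqP/imsetP => [->|[j _ [-> _]]//].
  by exists b.
by rewrite card_imset ?cardsT ?card_ord // => a b [].
Qed.

Lemma online_kchoosable_multipartite (m k N : nat) :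
  (forall q, 0 < q <= m -> cumul None m q * k.-1 + q <= q * N) ->
  online_kchoosable (complete_multipartite m k) N.
Proof.
move=> leN.
pose G := complete_multipartite m k.
apply: (@safe_bob_wins G _ fst (fun=> N) [ffun=> 0] [set: G] (fun=> None)).
  by [].
move=> i Q Qi.
rewrite /bound (eq_bigr (fun=> cumul None m #|Q|)) => [|h _]; last first.
  by rewrite card_multipartite_part.
rewrite sum_nat_const cardC1 card_ord mulnC (eq_bigr (fun=> N)) => [|v _].
  rewrite sum_nat_const.
  have [->|Q0] := posnP #|Q|; first by rewrite /cumul big_ord0.
  by apply: leN; rewrite Q0 -(@card_multipartite_part m k i) subset_leq_card.
by rewrite ffunE subn0.
Qed.

Lemma online_choice_number_multipartite (m k : nat) : 0 < k -> 0 < m ->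
  exists2 q, 0 < q <= m &
    q * online_choice_number (complete_multipartite m k)
      < cumul None m q * k.-1 + q.*2.
Proof.
move=> k0 m0; have [_ minN] := online_choice_numberP (complete_multipartite m k).
set N := online_choice_number _ in minN *.
case: (pickP (fun q : 'I_m => q.+1 * N < cumul None m q.+1 * k.-1 + q.+1.*2)).
  by move=> q Nq; exists q.+1 => //=; exact: ltn_ord.
move=> H; have /minN : online_kchoosable (complete_multipartite m k) N.-1.
  apply: online_kchoosable_multipartite => -[//|q] /= qm.
  by have /= := H (Ordinal qm); case: N {H minN} => [|N] /=; rewrite ?mulnS; lia.
(* The case [q = 1] excludes [N = 0], where [N.-1] would equal [N]. *)
have /= := H (Ordinal m0); rewrite /cumul big_ord1 /=.
by case: N {H minN} => [|N] /=; lia.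
Qed.

(** * The bound over the reals *)

Local Open Scope ring_scope.

Theorem corollary11 (R : rcfType) (m k : nat) (hm : (3 <= m)%N) (hk : (0 < k)%N) :
  (online_choice_number (complete_multipartite m k))%:R
    <= (m%:R + 1 / 2 - Num.sqrt (2 * m%:R - 2)) * k%:R :> R.
Proof.
have m0 : (0 < m)%N by apply: leq_trans hm.
have [q /andP[q0 qm]] := online_choice_number_multipartite hk m0.
set N := online_choice_number _ => Nq.
have cE := cumul_freeE (introT andP (conj q0 qm)).
set c := cumul None m q in Nq cE.
(* By [Nq], [2 * q <= c.+1] gives the first case. It fails only for [m = q = 3], where the
   coefficient of [k] in the goal is 3/2. *)
have [Nc|[m3 Nk]] : (q * N <= c * k)%N \/ m = 3 /\ (2 * N <= 3 * k)%N.
- case: (ltngtP m 3) hm => // [m4 _|m3 _]; last first.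
    subst m; have [q3|q3] := eqVneq q 3; first by right; split=> //; nia.
    by left; nia.
  left; have [q1|q1] := eqVneq q 1; first by nia.
  have c_ge : (2 * q <= c.+1)%N by nia.
  by nia.
- have s2 : Num.sqrt (2 * m%:R - 2) ^+ 2 = 2 * m%:R - 2 :> R.
    by rewrite sqr_sqrtr // subr_ge0 ler_peMr // ler1n.
  move: (Num.sqrt _) s2 => s s2.
  have q0R : 0 < q%:R :> R by rewrite ltr0n.
  rewrite -(ler_pM2l q0R) mulrA.
  apply: (@le_trans _ _ (c%:R * k%:R)); first by rewrite -!natrM ler_nat.
  apply: ler_wpM2r; first exact: ler0n.
  (* As [s ^+ 2 = 2 * m - 2], twice the difference of the two sides is [(s - q) ^+ 2]. *)
  have := congr1 (fun a : nat => a%:R : R) cE.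
  rewrite !(natrD, natrM) -subn1 natrB // => cER.
  have := sqr_ge0 (s - q%:R); nra.
- rewrite m3 (_ : 2 * 3%:R - 2 = 2 ^+ 2) ?sqrtr_sqr ?normr_nat; last by ring.
  have : (2 * N)%:R <= (3 * k)%:R :> R by rewrite ler_nat.
  by rewrite !natrM; lra.
Qed.
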